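(* Let $\mathcal{F}=\{E_1|H_1,\ldots,E_n|H_n\}$ be a family of $n$ conditional events and let $\overline{\mathcal{F}}=\{\overline{E}_1|H_1,\ldots,\overline{E}_n|H_n\}$. Then: (i) $\overline{\mathcal{D}(\mathcal{F})}=\mathcal{C}(\overline{\mathcal{F}})$, that is $\mathcal{D}(\mathcal{F})=\overline{\mathcal{C}(\overline{\mathcal{F}})}$; (ii) $\overline{\mathcal{C}(\mathcal{F})}=\mathcal{D}(\overline{\mathcal{F}})$, that is $\mathcal{C}(\mathcal{F})=\overline{\mathcal{D}(\overline{\mathcal{F}})}$.
   Context: Events are two-valued propositions (identified with subsets of the sure event $\Omega$, and with their indicators); $\overline{A}$ is negation, $AB$ is conjunction. For events $E,H$ with $H\neq\emptyset$, the conditional event $E|H$ is true if $EH$ is true, false if $\overline{E}H$ is true, void if $\overline{H}$ is true. For a random quantity $X$ with finitely many values and $H\ne\emptyset$, a conditional random quantity $X|H$ with assessed prevision $\mu=\mathbb{P}(X|H)$ is identified with the random quantity $XH+\mu\overline{H}$; in particular $E|H=EH+x\overline{H}$ with $x=P(E|H)$. Coherence: an assessment of previsions $\mu_j=\mathbb{P}(X_j|K_j)$ on a family of conditional random quantities is coherent if, for every finite subfamily $\{X_1|K_1,\ldots,X_r|K_r\}$ and all real $s_1,\ldots,s_r$, the gain $G=\sum_j s_jK_j(X_j-\mu_j)$ restricted to $K_1\vee\cdots\vee K_r$ satisfies $\min G\leq 0\leq\max G$. Conjunction and disjunction. For a family $\mathcal{F}=\{E_1|H_1,\ldots,E_n|H_n\}$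 and each nonempty $S\subseteq\{1,\ldots,n\}$, let $x_S$ and $y_S$ denote the previsions of $\bigwedge_{i\in S}(E_i|H_i)$ and $\bigvee_{i\in S}(E_i|H_i)$ ($x_{\{i\}}=y_{\{i\}}=P(E_i|H_i)$). The conjunction $\bigwedge_{i\in S}(E_i|H_i)$ is the random quantity, conditional on $\bigvee_{i\in S}H_i$, with value $1$ if all $E_i|H_i$, $i\in S$, are true; $0$ if at least one is false; $x_V$ if none is false and the set $V\subseteq S$ of indices of void ones is nonempty. The disjunction $\bigvee_{i\in S}(E_i|H_i)$ is the random quantity, conditional on $\bigvee_{i\in S}H_i$, with value $1$ if at least one $E_i|H_i$, $i\in S$, is true; $0$ if all are false; $y_V$ if none is true and the set $V\subseteq S$ of indices of void ones is nonempty. $\mathcal{C}(\mathcal{F})$ and $\mathcal{D}(\mathcal{F})$ are the conjunction and disjunction for $S=\{1,\ldots,n\}$. Negation: $\overline{\mathcal{C}(\mathcal{F})}=1-\mathcal{C}(\mathcal{F})$ and $\overline{\mathcal{D}(\mathcal{F})}=1-\mathcal{D}(\mathcal{F})$. Convention: the previsions of all conjunctions and disjunctions involved (for $\mathcal{F}$ and $\overline{\mathcal{F}}$ and their subfamilies) are always taken to form a jointly coherent assessment, and equalities between compounds are equalities of random quantities (on all of $\Omega$), for every such coherent assessment. *)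

(* Defs.v *)
From HB Require Import structures.
From mathcomp Require Import all_boot all_order all_algebra.
From mathcomp Require Import all_classical all_reals all_analysis.

Set Implicit Arguments.
Unset Strict Implicit.
Unset Printing Implicit Defensive.

Import Order.TTheory GRing.Theory Num.Theory.
Local Open Scope classical_set_scope.
Local Open Scope ring_scope.

(** The sure event is the type [T]; events are subsets
    [set T]; random quantities are functions [T -> R].  Index sets
    [S : {set 'I_n}] are MathComp finite sets (delimiter [%SET]). *)

Record cond_event (T : Type) := CondEvent {
  ce_event : set T;
  ce_cond : set T;
  ce_cond_neq0 : ce_cond !=set0 }.

Definition ce_neg (T : Type) (A : cond_event T) : cond_event T :=
  CondEvent (~` ce_event A) (ce_cond_neq0 A).

Section TruthValues.
Variables (T : Type) (A : cond_event T) (w : T).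

Definition ce_true : bool := w \in ce_event A `&` ce_cond A.
Definition ce_false : bool := w \in ~` ce_event A `&` ce_cond A.
Definition ce_void : bool := w \in ~` ce_cond A.

End TruthValues.

Section Coherence.
Variables (R : realType) (T : Type).

(** [X|K] together with its assessed prevision [mu].  The gain only involves
    the values of [X] on [K]. *)
Record assessed := Assessed {
  as_quantity : T -> R;
  as_cond : set T;
  as_prevision : R }.

Definition gain (r : nat) (a : 'I_r -> assessed) (s : 'I_r -> R) (w : T) : R :=
  \sum_(j < r) s j * \1_(as_cond (a j)) w
               * (as_quantity (a j) w - as_prevision (a j)).

Definition min_le0_max_ge0 (V : set R) : Prop :=
  (exists2 m, V m /\ lbound V m & m <= 0) /\
  (exists2 M, V M /\ ubound V M & 0 <= M).

(** A finite subfamily is enumerated by [a : 'I_r -> assessed] with [0 < r].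
    Repetitions are harmless: repeated terms of the gain merge into one, with
    the corresponding [s j] added up.  Quantities with finitely many values
    have gains with finitely many values, so that the minimum and the maximum
    are always attained. *)
Definition coherent (P : set assessed) : Prop :=
  forall (r : nat) (a : 'I_r -> assessed) (s : 'I_r -> R),
    (0 < r)%N -> (forall j, P (a j)) ->
    min_le0_max_ge0 (gain a s @` \bigcup_j as_cond (a j)).

End Coherence.

Section Compounds.
Variables (R : realType) (T : Type) (n : nat) (F : 'I_n -> cond_event T).

Definition void_set (S : {set 'I_n}) (w : T) : {set 'I_n} :=
  [set i in S | ce_void (F i) w]%SET.

Definition cond_join (S : {set 'I_n}) : set T :=
  \bigcup_(i in [set` S]) ce_cond (F i).

(** [x V] (resp. [y V]) is the prevision of the conjunction (resp. disjunction)
    of the subfamily [V]; the value at the empty set is never used for a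
    nonempty [S].  Outside [cond_join S] every member is void and the compound
    takes the value [x S] (resp. [y S]), its own prevision, in accordance with
    the identification of [X|K] with [X K + mu (~ K)]. *)
Definition conjunction (x : {set 'I_n} -> R) (S : {set 'I_n}) (w : T) : R :=
  if [forall i in S, ce_true (F i) w] then 1
  else if [exists i in S, ce_false (F i) w] then 0
  else x (void_set S w).

Definition disjunction (y : {set 'I_n} -> R) (S : {set 'I_n}) (w : T) : R :=
  if [exists i in S, ce_true (F i) w] then 1
  else if [forall i in S, ce_false (F i) w] then 0
  else y (void_set S w).

Definition compound_assessment (x y : {set 'I_n} -> R) : set (assessed R T) :=
  [set Assessed (conjunction x S) (cond_join S) (x S)
    | S in [set S : {set 'I_n} | S != finset.set0]] `|`
  [set Assessed (disjunction y S) (cond_join S) (y S)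
    | S in [set S : {set 'I_n} | S != finset.set0]].

End Compounds.

Definition rq_neg (R : realType) (T : Type) (X : T -> R) : T -> R :=
  fun w => 1 - X w.

Definition family_neg (T : Type) (n : nat) (F : 'I_n -> cond_event T) :
    'I_n -> cond_event T :=
  fun i => ce_neg (F i).

(* Main.v *)
Require Import Defs.
From HB Require Import structures.
From mathcomp Require Import all_boot all_order all_algebra.
From mathcomp Require Import all_classical all_reals all_analysis.

Set Implicit Arguments.
Unset Strict Implicit.
Unset Printing Implicit Defensive.

Import Order.TTheory GRing.Theory Num.Theory.
Local Open Scope classical_set_scope.
Local Open Scope ring_scope.

(** At every outcome, the disjunction of a family and the conjunction of the
    negated family are either both decided, with truth values adding up to
    [1], or both equal to the prevision of the compound of the same void
    members.  The duality is therefore a matter of previsions: it amounts to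
    [y S + xN S = 1] for every nonempty [S], where [y S] and [xN S] are the
    previsions of the disjunction over [S] and of the conjunction of
    the negated members of [S] ([disjunction_conjunction_neg_prevision]).

    That identity comes from coherence by induction on the size of [S].  On
    the event that some member of [S] is not void, the void members form a
    proper subset of [S], so by induction the two compounds add up to [1]
    there.  Betting one unit on each of them then yields the constant gain
    [1 - (y S + xN S)], and coherence forces a constant gain to vanish
    ([coherent_prevision_add]).

    Negating a family twice gives it back, so the second De Morgan law is the
    first one for the negated family. *)

Section CoherentPrevisions.
Variables (R : realType) (T : Type).

(** Additivity of coherent previsions in the case needed here: a sure sum on
    the common conditioning event [K] makes the gain of the two unit bets
    constant; its minimum is nonpositive and its maximum nonnegative, and both
    are that constant. *)
Lemma coherent_prevision_add (P : set (assessed R T)) (K : set T)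
    (X Y : T -> R) (mu nu c : R) :
  coherent P -> P (Assessed X K mu) -> P (Assessed Y K nu) ->
  (forall w, K w -> X w + Y w = c) -> mu + nu = c.
Proof.
move=> cohP PX PY XYc.
pose a (j : 'I_2) := if j == ord0 then Assessed X K mu else Assessed Y K nu.
have Pa j : P (a j) by rewrite /a; case: ifP.
have gain_cst g :
    (gain a (fun=> 1) @` \bigcup_j as_cond (a j)) g -> g = c - (mu + nu).
  case=> w [j _ aw] <-.
  have Kw : K w by move: aw; rewrite /a; case: ifP.
  rewrite /gain big_ord_recl big_ord1 /= indicE mem_set // !mul1r -(XYc w Kw).
  by rewrite opprD addrACA.
have [[m [/gain_cst -> _] le0] [M [/gain_cst -> _] ge0]] :=
  cohP 2%N a (fun=> 1) isT Pa.
by apply/esym/eqP; rewrite -subr_eq0 eq_le le0.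
Qed.

End CoherentPrevisions.

Section DeMorgan.
Variables (R : realType) (T : Type) (n : nat).
Implicit Types (F : 'I_n -> cond_event T) (S : {set 'I_n}) (x y : {set 'I_n} -> R).

Lemma ce_false_neg (A : cond_event T) w : ce_false (ce_neg A) w = ce_true A w.
Proof. by rewrite /ce_false /ce_true /= setCK. Qed.

Lemma family_negK : involutive (@family_neg T n).
Proof.
move=> F; apply/funext => i; rewrite /family_neg /ce_neg /=.
by case: (F i) => E H H0 /=; rewrite setCK.
Qed.

Lemma ce_trueVfalseVvoid (A : cond_event T) w :
  [|| ce_true A w, ce_false A w | ce_void A w].
Proof.
by rewrite /ce_true /ce_false /ce_void !in_setI !in_setC; do 2 case: (w \in _).
Qed.

Lemma void_set_neq0 F S w :
  ~~ [exists i in S, ce_true (F i) w] -> ~~ [forall i in S, ce_false (F i) w] ->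
  void_set F S w != finset.set0.
Proof.
move=> /exists_inPn noT; rewrite negb_forall_in => /exists_inP[i iS nF].
apply/finset.set0Pn; exists i; rewrite inE iS /=.
by have := ce_trueVfalseVvoid (F i) w; rewrite (negbTE (noT i iS)) (negbTE nF).
Qed.

Lemma void_set_proper F S w : cond_join F S w -> void_set F S w \proper S.
Proof.
move=> [i /= iS Hi]; apply/properP; split.
  by apply/fintype.subsetP => j; rewrite inE => /andP[].
exists i => //; rewrite inE iS /= /ce_void in_setC negbK.
exact: mem_set.
Qed.

(** A member is true exactly when its negation is false, and void exactly when
    its negation is void, so the case distinctions defining the two compounds
    coincide. *)
Lemma disjunction_add_conjunction_neg F S xN y w :
  (void_set F S w != finset.set0 ->
     y (void_set F S w) + xN (void_set F S w) = 1) ->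
  disjunction F y S w + conjunction (family_neg F) xN S w = 1.
Proof.
move=> yxN; rewrite /disjunction /conjunction.
have -> : [forall i in S, ce_true (family_neg F i) w]
        = [forall i in S, ce_false (F i) w] by [].
have -> : [exists i in S, ce_false (family_neg F i) w]
        = [exists i in S, ce_true (F i) w].
  by apply: eq_existsb => i; rewrite ce_false_neg.
have -> : void_set (family_neg F) S w = void_set F S w by [].
have [/exists_inP[i iS Ti]|noT] := boolP [exists i in S, ce_true (F i) w].
  rewrite ifN ?addr0 // negb_forall_in; apply/exists_inP; exists i => //.
  by move: Ti; rewrite /ce_true /ce_false !in_setI in_setC => /andP[-> _].
have [_|nallF] := boolP [forall i in S, ce_false (F i) w]; first by rewrite add0r.
exact/yxN/void_set_neq0.
Qed.

(** Strong induction on [#|S|]: the previsions that the compounds over [S]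
    take as values inside their conditioning event belong to proper subsets
    of [S]. *)
Lemma disjunction_conjunction_neg_prevision F x y xN yN :
  coherent (compound_assessment F x y `|`
            compound_assessment (family_neg F) xN yN) ->
  forall S, S != finset.set0 -> y S + xN S = 1.
Proof.
move=> coh S; have [k] := ubnP #|S|; elim: k S => // k IH S ltSk S0.
have PD : (compound_assessment F x y `|`
           compound_assessment (family_neg F) xN yN)
            (Assessed (disjunction F y S) (cond_join F S) (y S)).
  by left; right; exists S.
(* Negation keeps the conditioning events, so both bets are on the same event. *)
have PC : (compound_assessment F x y `|`
           compound_assessment (family_neg F) xN yN)
            (Assessed (conjunction (family_neg F) xN S) (cond_join F S) (xN S)).
  by right; left; exists S.
apply: (coherent_prevision_add coh PD PC) => w /void_set_proper/proper_card ltVS.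
apply: disjunction_add_conjunction_neg; apply: IH.
exact: leq_trans ltVS _.
Qed.

Lemma rq_neg_disjunction F x y xN yN S :
  coherent (compound_assessment F x y `|`
            compound_assessment (family_neg F) xN yN) ->
  rq_neg (disjunction F y S) = conjunction (family_neg F) xN S.
Proof.
move=> coh; apply/funext => w; apply/eqP; rewrite /rq_neg subr_eq addrC eq_sym.
apply/eqP/disjunction_add_conjunction_neg.
exact: disjunction_conjunction_neg_prevision coh _.
Qed.

Lemma rq_negK : involutive (@rq_neg R T).
Proof. by move=> X; apply/funext => w; rewrite /rq_neg subKr. Qed.

End DeMorgan.

Theorem theorem5 (R : realType) (T : Type) (n : nat) (n_gt0 : (0 < n)%N)
    (F : 'I_n -> cond_event T)
    (* previsions of the conjunctions and disjunctions of F and its negation *)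
    (x y xN yN : {set 'I_n} -> R)
    (xy1 : forall i : 'I_n, x [set i]%SET = y [set i]%SET)
    (xyN1 : forall i : 'I_n, xN [set i]%SET = yN [set i]%SET)
    (coh : coherent (compound_assessment F x y `|`
                     compound_assessment (family_neg F) xN yN)) :
  let C := conjunction F x [set: 'I_n]%SET in
  let D := disjunction F y [set: 'I_n]%SET in
  let CN := conjunction (family_neg F) xN [set: 'I_n]%SET in
  let DN := disjunction (family_neg F) yN [set: 'I_n]%SET in
  (rq_neg D = CN /\ D = rq_neg CN) /\ (rq_neg C = DN /\ C = rq_neg DN).
Proof.
move=> C D CN DN.
have negD : rq_neg D = CN by exact: rq_neg_disjunction _ coh.
have negDN : rq_neg DN = C.
  have cohN :
      coherent (compound_assessment (family_neg F) xN yN `|`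
                compound_assessment (family_neg (family_neg F)) x y).
    by rewrite family_negK setUC.
  by have := rq_neg_disjunction [set: 'I_n]%SET cohN; rewrite family_negK.
by rewrite -negD -negDN !rq_negK.
Qed.
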